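(* Let $F\colon \mathsf{Set}\to\mathsf{Set}$ be a Kripke polynomial functor. Then $F$ has a terminal coalgebra obtained in $\omega+\omega$ steps: the limit $V_{\omega+\omega}$ (defined below) is preserved by $F$, so the canonical morphism $FV_{\omega+\omega}\to V_{\omega+\omega}$ is an isomorphism and its inverse $V_{\omega+\omega}\to FV_{\omega+\omega}$ is a terminal $F$-coalgebra; i.e. $\nu F = V_{\omega+\omega}$.
   Context: Kripke polynomial functors are the endofunctors of $\mathsf{Set}$ generated by the grammar $F ::= \mathcal{P}_f \mid A \mid \mathrm{Id} \mid \prod_{i\in I} F_i \mid \coprod_{i\in I} F_i \mid F F$, where $\mathcal{P}_f$ is the finite power-set functor ($\mathcal{P}_f X$ = set of finite subsets of $X$, $\mathcal{P}_f f(S)=f[S]$), $A$ ranges over all sets (as constant functors), $I$ is an arbitrary index set, products and coproducts are pointwise, and $FF$ denotes composition. Terminal-coalgebra chain: let $1$ be a terminal object, $V_0=1$, $V_{n+1}=FV_n$, with connecting maps $v_0\colon V_1\to V_0$ the unique map and $v_{n+1}=Fv_n$. Let $V_\omega=\lim_{n<\omega}V_n$ with limit projections $\ell_n\colon V_\omega\to V_n$, and let $m\colon FV_\omega\to V_\omega$ be the unique morphism with $\ell_{n+1}\circ m = F\ell_n$ for all $n<\omega$. Put $V_{\omega+0}=V_\omega$, $V_{\omega+n+1}=FV_{\omega+n}$, with connecting maps $F^n m\colon V_{\omega+n+1}\to V_{\omega+n}$, and $V_{\omega+\omega}=\lim_{n<\omega}V_{\omega+n}$ with projections $\bar\ell_n$.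 The canonical morphism $FV_{\omega+\omega}\to V_{\omega+\omega}$ is the one induced by the cone $F\bar\ell_n\colon FV_{\omega+\omega}\to FV_{\omega+n}=V_{\omega+n+1}$. *)

(* Defs.v *)
From mathcomp Require Import all_boot.
From mathcomp Require Import boolp classical_sets functions cardinality.

Set Implicit Arguments.
Unset Strict Implicit.
Unset Printing Implicit Defensive.

Local Open Scope classical_set_scope.

(* The category Set: the types of one fixed universe and all functions between
   them. Naming the universe makes the constant sets, the index sets, and the
   carriers of coalgebras range over the same sets. *)
Definition SET := Type.

Record functor := Functor {
  fobj :> SET -> SET;
  fmap : forall X Y : SET, (X -> Y) -> fobj X -> fobj Y;
  fmap_id : forall X : SET, fmap (@id X) = id;
  fmap_comp : forall (X Y Z : SET) (g : Y -> Z) (f : X -> Y),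
    fmap (g \o f) = fmap g \o fmap f }.

Arguments fmap F {X Y} f : rename.

Definition Pf_obj (X : SET) : SET := {S : set X | finite_set S}.

Lemma Pf_inj (X : SET) (x y : Pf_obj X) : sval x = sval y -> x = y.
Proof.
case: x y => [x xP] [y yP] /= xy; case: _ / xy yP => yP.
by rewrite (Prop_irrelevance xP yP).
Qed.

Definition Pf_map (X Y : SET) (f : X -> Y) (S : Pf_obj X) : Pf_obj Y :=
  exist _ (f @` sval S) (finite_image f (svalP S)).

Lemma Pf_map_id (X : SET) : Pf_map (@id X) = id.
Proof. by apply/funext => S; apply: Pf_inj; rewrite /= image_id. Qed.

Lemma Pf_map_comp (X Y Z : SET) (g : Y -> Z) (f : X -> Y) :
  Pf_map (g \o f) = Pf_map g \o Pf_map f.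
Proof. by apply/funext => S; apply: Pf_inj; rewrite /= image_comp. Qed.

Definition PfF : functor := Functor Pf_map_id Pf_map_comp.

Definition constF (A : SET) : functor :=
  @Functor (fun=> A) (fun _ _ _ => id) (fun=> erefl) (fun _ _ _ _ _ => erefl).

Definition idF : functor :=
  @Functor (fun X => X) (fun _ _ f => f) (fun=> erefl) (fun _ _ _ _ _ => erefl).

Section Pointwise.
Variables (I : SET) (F : I -> functor).

Definition prod_obj (X : SET) : SET := forall i, F i X.

Definition prod_map (X Y : SET) (f : X -> Y) (x : prod_obj X) : prod_obj Y :=
  fun i => fmap (F i) f (x i).

Lemma prod_map_id (X : SET) : prod_map (@id X) = id.
Proof.
by apply/funext => x; apply: functional_extensionality_dep => i;
  rewrite /prod_map fmap_id.
Qed.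

Lemma prod_map_comp (X Y Z : SET) (g : Y -> Z) (f : X -> Y) :
  prod_map (g \o f) = prod_map g \o prod_map f.
Proof.
by apply/funext => x; apply: functional_extensionality_dep => i;
  rewrite /prod_map fmap_comp.
Qed.

Definition prodF : functor := Functor prod_map_id prod_map_comp.

Definition coprod_obj (X : SET) : SET := {i : I & F i X}.

Definition coprod_map (X Y : SET) (f : X -> Y) (x : coprod_obj X) :
  coprod_obj Y := existT _ (projT1 x) (fmap (F (projT1 x)) f (projT2 x)).

Lemma coprod_map_id (X : SET) : coprod_map (@id X) = id.
Proof. by apply/funext => -[i x]; rewrite /coprod_map fmap_id. Qed.

Lemma coprod_map_comp (X Y Z : SET) (g : Y -> Z) (f : X -> Y) :
  coprod_map (g \o f) = coprod_map g \o coprod_map f.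
Proof. by apply/funext => -[i x]; rewrite /coprod_map /= fmap_comp. Qed.

Definition coprodF : functor := Functor coprod_map_id coprod_map_comp.

End Pointwise.

Section Composition.
Variables F G : functor.

Lemma comp_map_id (X : SET) : fmap F (fmap G (@id X)) = id.
Proof. by rewrite !fmap_id. Qed.

Lemma comp_map_comp (X Y Z : SET) (g : Y -> Z) (f : X -> Y) :
  fmap F (fmap G (g \o f)) = fmap F (fmap G g) \o fmap F (fmap G f).
Proof. by rewrite (fmap_comp G) (fmap_comp F). Qed.

Definition compF : functor :=
  @Functor (fun X => F (G X)) (fun _ _ f => fmap F (fmap G f))
    comp_map_id comp_map_comp.

End Composition.

Inductive kripke_polynomial : functor -> Prop :=
| KP_Pf : kripke_polynomial PfF
| KP_const (A : SET) : kripke_polynomial (constF A)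
| KP_id : kripke_polynomial idF
| KP_prod (I : SET) (F : I -> functor) :
    (forall i, kripke_polynomial (F i)) -> kripke_polynomial (prodF F)
| KP_coprod (I : SET) (F : I -> functor) :
    (forall i, kripke_polynomial (F i)) -> kripke_polynomial (coprodF F)
| KP_comp (F G : functor) :
    kripke_polynomial F -> kripke_polynomial G ->
    kripke_polynomial (compF F G).

(* Diagrams ... -> C 2 -> C 1 -> C 0 *)
Record chain := Chain {
  chain_ob :> nat -> SET;
  chain_map : forall n, chain_ob n.+1 -> chain_ob n }.

Arguments chain_map : clear implicits.

Definition is_cone (C : chain) (T : SET) (q : forall n, T -> C n) : Prop :=
  forall n, chain_map C n \o q n.+1 = q n.

Definition is_limit (C : chain) (L : SET) (p : forall n, L -> C n) : Prop :=
  is_cone p /\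
  forall (T : SET) (q : forall n, T -> C n), is_cone q ->
    exists! u : T -> L, forall n, p n \o u = q n.

Definition map_chain (F : functor) (C : chain) : chain :=
  @Chain (fun n => F (C n)) (fun n => fmap F (chain_map C n)).

Definition preserves_limit (F : functor) (C : chain) (L : SET)
    (p : forall n, L -> C n) : Prop :=
  is_limit p -> @is_limit (map_chain F C) (F L) (fun n => fmap F (p n)).

Definition lim (C : chain) : SET :=
  {x : forall n, C n | forall n, chain_map C n (x n.+1) = x n}.

Definition lim_proj (C : chain) (n : nat) (x : lim C) : C n := sval x n.

Arguments lim_proj C n x : clear implicits.

Lemma lim_inj (C : chain) (x y : lim C) : sval x = sval y -> x = y.
Proof.
case: x y => [x xP] [y yP] /= xy; case: _ / xy yP => yP.
by rewrite (Prop_irrelevance xP yP).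
Qed.

Definition lim_lift (C : chain) (T : SET) (q : forall n, T -> C n)
    (qP : is_cone q) (t : T) : lim C :=
  exist (fun x : forall n, C n => forall n, chain_map C n (x n.+1) = x n)
    (fun n => q n t) (fun n => congr1 (@^~ t) (qP n)).

Lemma lim_proj_cone (C : chain) : is_cone (lim_proj C).
Proof. by move=> n; apply/funext => x; apply: (svalP x). Qed.

Lemma lim_is_limit (C : chain) : is_limit (lim_proj C).
Proof.
split=> [|T q qP]; first exact: lim_proj_cone.
exists (lim_lift qP); split=> // u uP.
apply/funext => t; apply: lim_inj; apply: functional_extensionality_dep => n.
by rewrite /= -(uP n).
Qed.

Section IteratedChain.
Variables (F : functor) (X : SET) (a : F X -> X).

Fixpoint iter_ob (n : nat) : SET := if n is k.+1 then F (iter_ob k) else X.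

Fixpoint iter_map (n : nat) : iter_ob n.+1 -> iter_ob n :=
  if n is k.+1 then fmap F (@iter_map k) else a.

(* X <- F X <- F (F X) <- ... with connecting maps a, F a, F (F a), ... *)
Definition iter_chain : chain := Chain iter_map.

Definition canon_cone (n : nat) : F (lim iter_chain) -> iter_chain n :=
  chain_map iter_chain n \o fmap F (lim_proj iter_chain n).

Lemma canon_coneP : is_cone canon_cone.
Proof.
move=> n; rewrite /canon_cone -[RHS]/(iter_map (n := n) \o _).
by rewrite -(lim_proj_cone iter_chain n) fmap_comp.
Qed.

(* The maps F (lim_proj n) : F (lim iter_chain) -> iter_chain n.+1 form a cone
   on the chain without its first term; its component at 0 is then forced. *)
Definition canon : F (lim iter_chain) -> lim iter_chain :=
  lim_lift canon_coneP.

Lemma canonE (n : nat) :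
  lim_proj iter_chain n.+1 \o canon = fmap F (lim_proj iter_chain n).
Proof. by rewrite -[in RHS](lim_proj_cone iter_chain n) fmap_comp. Qed.

Lemma canon_unique (m : F (lim iter_chain) -> lim iter_chain) :
  (forall n, lim_proj iter_chain n.+1 \o m = fmap F (lim_proj iter_chain n)) ->
  m = canon.
Proof.
move=> mP; apply/funext => y; apply: lim_inj.
apply: functional_extensionality_dep => n.
rewrite -[LHS]/((lim_proj iter_chain n \o m) y).
by rewrite -(lim_proj_cone iter_chain n) -compA mP.
Qed.

End IteratedChain.

Section TerminalChain.
Variable F : functor.

Definition V_fin : chain := @iter_chain F unit (fun=> tt).

Definition V_omega : SET := lim V_fin.

Definition m_omega : F V_omega -> V_omega := @canon F unit (fun=> tt).

(* The chain of the V_{omega + n}, n < omega *)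
Definition V_omega_plus : chain := iter_chain m_omega.

Definition V_omega_omega : SET := lim V_omega_plus.

Definition canon_omega_omega : F V_omega_omega -> V_omega_omega :=
  canon (a := m_omega).

End TerminalChain.

Definition coalgebra_hom (F : functor) (X Y : SET) (c : X -> F X)
    (d : Y -> F Y) (h : X -> Y) : Prop :=
  d \o h = fmap F h \o c.

Definition terminal_coalgebra (F : functor) (Y : SET) (d : Y -> F Y) : Prop :=
  forall (X : SET) (c : X -> F X), exists! h : X -> Y, coalgebra_hom c d h.

(* Main.v *)
Require Import Defs.
From mathcomp Require Import all_boot.
From mathcomp Require Import boolp classical_sets cardinality.

(** Polynomial functors and the finite power set preserve jointly injective
    cones over omega^op-chains; for the finite power set this is the pigeonhole
    principle. Hence [m : F V_omega -> V_omega] is injective and, as [F] also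
    preserves injections, the chain of the [V_(omega + n)] consists of
    injections. Limits of such chains are decreasing intersections, and these
    are preserved by [F]: a compatible sequence of finite subsets is determined
    by its first member. Finally, unique solvability of [g = a \o F g \o e] for
    every coalgebra [e] passes from [a : F X -> X] to the canonical map of the
    limit of [X <- F X <- F (F X) <- ...]; it holds for [X = 1], so two passages
    give terminality. *)

Set Implicit Arguments.
Unset Strict Implicit.
Unset Printing Implicit Defensive.

Local Open Scope classical_set_scope.

Definition jointly_injective (C : chain) (L : SET) (p : forall n, L -> C n) :=
  forall x y : L, (forall n, p n x = p n y) -> x = y.

Definition compatible (C : chain) (x : forall n, C n) :=
  forall n, chain_map C n (x n.+1) = x n.

Definition jointly_surjective (C : chain) (L : SET) (p : forall n, L -> C n) :=
  forall x, compatible x -> exists l : L, forall n, p n l = x n.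

(** Maps out of a one-point set pick out elements, so uniqueness of mediating maps gives joint
    injectivity and existence gives joint surjectivity. Conversely, choice builds the mediating map
    pointwise. *)
Lemma is_limitP (C : chain) (L : SET) (p : forall n, L -> C n) :
  is_limit p <-> [/\ is_cone p, jointly_injective p & jointly_surjective p].
Proof.
split=> [[pC pU]|[pC pI pS]].
  split=> // [x y xy|x xC].
    have qC : is_cone (fun n (_ : unit) => p n x).
      by move=> n; apply/funext => t; rewrite -[RHS](congr1 (@^~ x) (pC n)).
    have [u [_ uU]] := pU _ _ qC.
    have ux : u = fun=> x by apply: uU.
    have uy : u = fun=> y.
      by apply: uU => n; apply/funext => t; rewrite /= xy.
    by rewrite -[LHS](congr1 (@^~ tt) ux) uy.
  have qC : is_cone (fun n (_ : unit) => x n) by move=> n; apply/funext.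
  have [u [uP _]] := pU _ _ qC.
  by exists (u tt) => n; rewrite -[RHS](congr1 (@^~ tt) (uP n)).
split=> // T q qC.
have /choice[u uP] : forall t, exists l, forall n, p n l = q n t.
  by move=> t; apply: pS => n; rewrite -[RHS](congr1 (@^~ t) (qC n)).
exists u; split=> [n|v vP]; first by apply/funext => t; exact: uP.
by apply/funext => t; apply: pI => n; rewrite uP -[LHS](congr1 (@^~ t) (vP n)).
Qed.

Lemma fmap_cone (F : functor) (C : chain) (L : SET) (p : forall n, L -> C n) :
  is_cone p -> @is_cone (map_chain F C) (F L) (fun n => fmap F (p n)).
Proof. by move=> pC n; rewrite /= -fmap_comp pC. Qed.

Lemma compatible_cone (C : chain) (L : SET) (p : forall n, L -> C n) (l : L) :
  is_cone p -> compatible (fun n => p n l).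
Proof. by move=> pC n; rewrite -[RHS](congr1 (@^~ l) (pC n)). Qed.

Lemma compatible_eq_le (C : chain) (x y : forall n, C n) (n m : nat) :
  compatible x -> compatible y -> n <= m -> x m = y m -> x n = y n.
Proof.
move=> xC yC /subnK <-; elim: (m - n) => // k IH xy.
by apply: IH; rewrite -xC -yC; congr (chain_map C _ _).
Qed.

Lemma compatible_eq0 (C : chain) (x y : forall n, C n) :
  (forall n, injective (chain_map C n)) ->
  compatible x -> compatible y -> x 0 = y 0 -> forall n, x n = y n.
Proof.
by move=> CI xC yC xy0; elim=> // n IH; apply: (CI n); rewrite xC yC.
Qed.

Lemma existT_inj (I : Type) (P : I -> Type) (i : I) (a b : P i) :
  existT P i a = existT P i b -> a = b.
Proof.
move=> ab; have := projT2_eq ab.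
by rewrite (Prop_irrelevance (projT1_eq ab) erefl).
Qed.

Lemma finite_set_bounded (X : Type) (A : set X) (f : X -> nat) :
  finite_set A -> exists N, forall x, A x -> f x <= N.
Proof.
move=> /(finite_image f)/finite_seqP[s fA].
exists (\max_(i <- s) i) => x Ax; apply: (@leq_bigmax_seq _ s xpredT id) => //.
by have : [set` s] (f x) by rewrite -fA; exists x.
Qed.

Definition preserves_jointly_injective (F : functor) :=
  forall (C : chain) (L : SET) (p : forall n, L -> C n),
    is_cone p -> jointly_injective p ->
    @jointly_injective (map_chain F C) (F L) (fun n => fmap F (p n)).

(** Were [x] in [S] but not in [T], each of the finitely many [t] in [T] would differ from [x] at
    some stage, hence at all later ones. A common bound [N] then contradicts that [p N x] lies in
    the image of [T]. *)
Lemma Pf_jointly_injective : preserves_jointly_injective PfF.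
Proof.
move=> C L p pC pI.
suff sub (S T : PfF L) : (forall n, fmap PfF (p n) S = fmap PfF (p n) T) ->
    sval S `<=` sval T.
  move=> S T ST; apply: Pf_inj; apply/seteqP; split; apply: sub => // n.
  exact: esym (ST n).
move=> ST x Sx; apply: contrapT => nTx.
have /choice[f fP] : forall t, exists n, sval T t -> p n t <> p n x.
  move=> t; apply: contrapT => /forallNP all_eq.
  have xt : t = x.
    by apply: pI => n; apply: contrapT => ne; apply: (all_eq n).
  by apply: (all_eq 0); rewrite xt => /nTx.
have [N fN] := finite_set_bounded f (svalP T).
have : sval (fmap PfF (p N) T) (p N x) by rewrite -ST; exists x.
move=> [t Tt ptx]; apply: (fP t Tt).
exact: (compatible_eq_le (compatible_cone t pC) (compatible_cone x pC)
  (fN t Tt) ptx).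
Qed.

Lemma kripke_jointly_injective (F : functor) :
  kripke_polynomial F -> preserves_jointly_injective F.
Proof.
elim=> {F} [|A|||I F _ IH|F G _ IHF _ IHG].
- exact: Pf_jointly_injective.
- by move=> C L p _ _ x y /(_ 0).
- by move=> C L p pC pI.
- move=> I F _ IH C L p pC pI x y xy.
  apply: functional_extensionality_dep => i; apply: (IH i) => // n.
  exact: (congr1 (@^~ i) (xy n)).
- move=> C L p pC pI [i x] [j y] xy.
  (* The maps of a coproduct keep the index, so stage 0 already compares it. *)
  have ij : i = j := congr1 (@projT1 _ _) (xy 0).
  case: _ / ij y xy => y xy; congr existT.
  by apply: (IH i) => // n; apply: existT_inj (xy n).
- move=> C L p pC pI; apply: (IHF (map_chain G C)); first exact: fmap_cone.
  exact: IHG.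
Qed.

(** An injection is a jointly injective cone over the constant chain of identities. *)
Lemma fmap_injective (F : functor) (X Y : SET) (f : X -> Y) :
  preserves_jointly_injective F -> injective f -> injective (fmap F f).
Proof.
move=> FI fI x y xy.
apply: (FI (Chain (fun _ : nat => @id Y)) X (fun=> f)) => // a b /(_ 0).
exact: fI.
Qed.

Definition preserves_intersections (F : functor) :=
  forall (C : chain) (L : SET) (p : forall n, L -> C n),
    (forall n, injective (chain_map C n)) ->
    is_cone p -> jointly_injective p -> jointly_surjective p ->
    @jointly_surjective (map_chain F C) (F L) (fun n => fmap F (p n)).

(** The witness is the preimage of [S 0] under [p 0], finite because [p 0] is injective. *)
Lemma Pf_intersections : preserves_intersections PfF.
Proof.
move=> C L p CI pC pI pS S SC.
have p0I : injective (p 0).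
  move=> x y xy; apply: pI.
  by apply: compatible_eq0 => //; exact: compatible_cone.
have down n y : sval (S n.+1) y -> sval (S n) (chain_map C n y).
  by move=> Sy; rewrite -(SC n); exists y.
have up n y : sval (S n) y -> exists z, sval (S n.+1) z /\ chain_map C n z = y.
  by rewrite -(SC n) => -[z Sz zy]; exists z.
(* The connecting maps send [S n.+1] onto [S n], so dependent choice extends [z0] to a thread, which
   [pS] realizes in [L]. *)
have thread0 z0 : sval (S 0) z0 ->
    exists l, p 0 l = z0 /\ forall n, sval (S n) (p n l).
  move=> Sz0.
  pose nxt n (y : {y | sval (S n) y}) : {z | sval (S n.+1) z} :=
    exist _ (sval (cid (up n _ (svalP y)))) (svalP (cid (up n _ (svalP y)))).1.
  pose z := fix z n : {y | sval (S n) y} :=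
    if n is k.+1 then nxt k (z k) else exist _ z0 Sz0.
  have [n|l lz] := pS (fun n => sval (z n)).
    exact: (svalP (cid (up n _ (svalP (z n))))).2.
  by exists l; split=> [|n]; rewrite lz //; exact: svalP.
have finT : finite_set (p 0 @^-1` sval (S 0)).
  by apply: finite_preimage (svalP (S 0)) => x y _ _; exact: p0I.
exists (exist _ _ finT) => n; apply: Pf_inj; apply/seteqP; split=> y /=.
  move=> [l Sl <-]; have [l' [l'l Sl']] := thread0 _ Sl.
  by rewrite -(p0I _ _ l'l).
(* The image of [y] one stage down comes from some [l]; injectivity of the connecting map forces [y]
   to come from the same [l]. *)
elim: n y => [|n IH] y Sy.
  by have [l [ly Sl]] := thread0 _ Sy; exists l => //; exact: Sl.
have [l Sl ly] := IH _ (down n y Sy); exists l => //.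
by apply: (CI n); rewrite (compatible_cone l pC).
Qed.

Lemma kripke_intersections (F : functor) :
  kripke_polynomial F -> preserves_intersections F.
Proof.
elim=> {F} [|A||I F _ IH|I F _ IH|F G _ IHF hG IHG].
- exact: Pf_intersections.
- move=> C L p _ _ _ _ x xC; exists (x 0) => n /=.
  by elim: n => // n ->; rewrite -(xC n).
- by move=> C L p.
- move=> C L p CI pC pI pS x xC.
  have lP i : exists l, forall n, fmap (F i) (p n) l = x n i.
    by apply: (IH i) => // n; exact: (congr1 (@^~ i) (xC n)).
  exists (fun i => sval (cid (lP i))) => n.
  by apply: functional_extensionality_dep => i; exact: (svalP (cid (lP i)) n).
(* The index is constant along the thread, which therefore lives in the single summand [F i]. *)
- move=> C L p CI pC pI pS x xC; pose i := projT1 (x 0).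
  have xi n : projT1 (x n) = i.
    by elim: n => // n <-; rewrite -(xC n).
  have yP n : exists y : F i (C n), x n = existT _ i y.
    by case: (x n) (xi n) => j y /= ji; case: _ / ji; exists y.
  have [n|l lx] := IH i C L p CI pC pI pS (fun n => sval (cid (yP n))).
    case: (cid (yP n)) (cid (yP n.+1)) => y xy [z xz] /=.
    by apply: (@existT_inj _ (fun j => F j (C n))); rewrite -xy -(xC n) xz.
  exists (existT _ i l) => n; rewrite (svalP (cid (yP n))).
  by rewrite -lx.
(* The outer functor acts on [map_chain G C], whose maps must again be injective. *)
- have GI := kripke_jointly_injective hG.
  move=> C L p CI pC pI pS; apply: (IHF (map_chain G C)).
  + by move=> n; apply: fmap_injective.
  + exact: fmap_cone.
  + exact: GI.
  + exact: IHG.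
Qed.

(** This says that [a] is a corecursive algebra; for invertible [a] it amounts to terminality of the
    inverse coalgebra. *)
Definition uniquely_solvable (F : functor) (X : SET) (a : F X -> X) :=
  forall (T : SET) (e : T -> F T), exists! g : T -> X, g = a \o fmap F g \o e.

Lemma canon_uniquely_solvable (F : functor) (X : SET) (a : F X -> X) :
  uniquely_solvable a -> uniquely_solvable (Defs.canon (a := a)).
Proof.
move=> aU T e; have [g [gE gU]] := aU T e.
(* The cone condition at 0 is the equation for [g]; applying [F] and precomposing with [e]
   propagates it upwards. *)
pose q := fix q n : T -> iter_chain a n :=
  if n is k.+1 then fmap F (q k) \o e else g.
have qC : is_cone q.
  elim=> [|n IH]; first by rewrite [RHS]/= [in RHS]gE.
  by rewrite -[q n.+1 in RHS]/(fmap F (q n) \o e) -IH fmap_comp.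
exists (lim_lift qC); split.
  apply/funext => t; apply: lim_inj; apply: functional_extensionality_dep => n.
  have lq k : lim_proj (iter_chain a) k \o lim_lift qC = q k by [].
  rewrite -[RHS]/((chain_map (iter_chain a) n \o
    (fmap F (lim_proj _ n) \o fmap F (lim_lift qC) \o e)) t).
  by rewrite -fmap_comp lq -[fmap F (q n) \o e]/(q n.+1) qC.
(* Component 0 of a solution [h] solves the equation for [a], so it is [g]; [step] then determines
   all later components. *)
move=> h hE.
have step n : lim_proj (iter_chain a) n.+1 \o h =
    fmap F (lim_proj (iter_chain a) n \o h) \o e.
  by rewrite [in LHS]hE fmap_comp -canonE.
have hq n : lim_proj (iter_chain a) n \o h = q n.
  elim: n => [|n IH]; last by rewrite step IH.
  apply/esym/gU.
  rewrite -[RHS]/(a \o (fmap F (lim_proj (iter_chain a) 0 \o h) \o e)) -step.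
  by rewrite -[in LHS](lim_proj_cone (iter_chain a) 0).
apply/funext => t; apply: lim_inj; apply: functional_extensionality_dep => n.
by rewrite -[RHS]/((lim_proj (iter_chain a) n \o h) t) hq.
Qed.

(** Followed by the projections [n.+1], the canonical map yields the jointly injective family of the
    [fmap F (lim_proj _ n)]. *)
Lemma canon_injective (F : functor) (X : SET) (a : F X -> X) :
  preserves_jointly_injective F -> injective (Defs.canon (a := a)).
Proof.
move=> FI x y xy.
have [pC pI _] := (is_limitP _).1 (@lim_is_limit (iter_chain a)).
apply: (FI _ _ _ pC pI) => n.
by rewrite -(canonE a n) -[LHS]/(lim_proj _ n.+1 (Defs.canon x)) xy.
Qed.

Lemma iter_map_injective (F : functor) (X : SET) (a : F X -> X) :
  preserves_jointly_injective F -> injective a ->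
  forall n, injective (chain_map (iter_chain a) n).
Proof. by move=> FI aI; elim=> //= n IH; apply: fmap_injective. Qed.

Lemma canon_surjective (F : functor) (X : SET) (a : F X -> X) :
  preserves_limit F (lim_proj (iter_chain a)) ->
  forall x, exists y, Defs.canon (a := a) y = x.
Proof.
move=> /(_ (@lim_is_limit _))/is_limitP[_ _ FS] x.
have xC : compatible (fun n => lim_proj (iter_chain a) n x) := svalP x.
(* The thread [x] shifted by one is a compatible family for [map_chain F]; its realization [y] is
   the preimage. *)
have [n|y yx] := FS (fun n => lim_proj (iter_chain a) n.+1 x).
  exact: (xC n.+1).
exists y; apply: lim_inj; apply: functional_extensionality_dep => n.
by rewrite /= /canon_cone /= yx; exact: xC.
Qed.

Theorem theorem3p5 (F : functor) (hF : kripke_polynomial F) :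
  preserves_limit F (lim_proj (V_omega_plus F)) /\
  exists c : V_omega_omega F -> F (V_omega_omega F),
    cancel (canon_omega_omega (F := F)) c /\
    cancel c (canon_omega_omega (F := F)) /\
    terminal_coalgebra c.
Proof.
have FI := kripke_jointly_injective hF.
have FV : preserves_limit F (lim_proj (V_omega_plus F)).
  move=> /is_limitP[pC pI pS]; apply/is_limitP; split.
  - exact: fmap_cone.
  - exact: FI.
  - apply: kripke_intersections => //.
    by apply: iter_map_injective => //; exact: canon_injective.
split=> //.
have [c cK] := choice (canon_surjective FV).
have Kc : cancel (canon_omega_omega (F := F)) c.
  by move=> x; apply: (canon_injective FI); rewrite cK.
exists c; do 2!split=> //.
have VU : uniquely_solvable (canon_omega_omega (F := F)).
  do 2!apply: canon_uniquely_solvable.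
  by move=> T e; exists (fun=> tt); split.
move=> T e; have [h [hE hU]] := VU T e; exists h; split=> [|k kE].
  by rewrite /coalgebra_hom [in LHS]hE; apply/funext => t; rewrite /= Kc.
(* As [c] is a section of the canonical map, a coalgebra morphism solves the fixed-point
   equation. *)
apply: hU; rewrite -compA -kE.
by apply/funext => t; rewrite /= [RHS]cK.
Qed.
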